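(* Let $\mathcal X = (X, \{R_i\}_{i=0}^d)$ be a symmetric association scheme with $d\ge 1$. Let $\{E_i\}_{i=0}^d$ denote a $Q$-polynomial ordering of the primitive idempotents of $\mathcal X$ (with $E_0=|X|^{-1}J$). Then the following are equivalent: (i) $\mathcal X$ is formally self-dual with respect to the ordering $\{E_i\}_{i=0}^d$; (ii) $\mathcal X$ is numerically self-dual with respect to the ordering $\{E_i\}_{i=0}^d$.
   Context: Let $d \ge 1$ be an integer. A ($d$-class) symmetric association scheme is a sequence $\mathcal X = (X, \{R_i\}_{i=0}^d)$ where $X$ is a finite nonempty set and $R_0,\ldots,R_d$ are nonempty subsets of $X\times X$ such that: (i) $X\times X$ is the disjoint union of $R_0,\ldots,R_d$; (ii) $R_0=\{(x,x): x\in X\}$; (iii) each $R_i$ is symmetric, i.e. $(x,y)\in R_i$ implies $(y,x)\in R_i$; (iv) there exist integers $p^h_{i,j}$ $(0\le h,i,j\le d)$, called the intersection numbers, such that for every $(x,y)\in R_h$, $p^h_{i,j}=|\{z\in X : (x,z)\in R_i,\ (z,y)\in R_j\}|$. The associate matrix $A_i\in \mathrm{Mat}_X(\mathbb C)$ has $(x,y)$-entry $1$ if $(x,y)\in R_i$ and $0$ otherwise. The matrices $\{A_i\}_{i=0}^d$ form a basis of a commutative algebra $\mathcal M$ (the Bose-Mesner algebra). $\mathcal M$ has a second basis $\{E_i\}_{i=0}^d$, the primitive idempotents, with $\sum_i E_i=I$, $E_iE_j=\delta_{i,j}E_i$, and $E_0=|X|^{-1}J$, where $J$ is the all ones matrix;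 an ordering of the primitive idempotents always has $E_0=|X|^{-1}J$. With respect to an ordering $\{E_i\}_{i=0}^d$, the first eigenmatrix $P$ and second eigenmatrix $Q$ in $\mathrm{Mat}_{d+1}(\mathbb C)$ (rows and columns indexed by $0,\ldots,d$) are defined by $A_j=\sum_{i=0}^d P_{i,j}E_i$ and $E_j=|X|^{-1}\sum_{i=0}^d Q_{i,j}A_i$ for $0\le j\le d$. The Krein parameters $q^h_{i,j}$ are defined by $E_i\circ E_j=|X|^{-1}\sum_{h=0}^d q^h_{i,j}E_h$ for $0\le i,j\le d$, where $\circ$ is the entry-wise product. $\mathcal X$ is formally self-dual with respect to the ordering $\{E_i\}_{i=0}^d$ if $P=Q$. $\mathcal X$ is numerically self-dual with respect to the ordering $\{E_i\}_{i=0}^d$ if $p^h_{i,j}=q^h_{i,j}$ for all $0\le h,i,j\le d$. The ordering $\{E_i\}_{i=0}^d$ is $Q$-polynomial if the corresponding Krein parameters satisfy, for all $0\le h,i,j\le d$: $q^h_{i,j}=0$ if one of $h,i,j$ is greater than the sum of the other two; and $q^h_{i,j}\ne 0$ if one of $h,i,j$ is equal to the sum of the other two. *)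

(* Defs.v *)
From HB Require Import structures.
From mathcomp Require Import all_boot all_order all_algebra.
From mathcomp Require Import reals.
From mathcomp Require Export complex.

Set Implicit Arguments.
Unset Strict Implicit.
Unset Printing Implicit Defensive.

Import GRing.Theory Num.Theory.
Local Open Scope ring_scope.

(* [inter_num h i j] is the intersection number p^h_{i,j}; it is determined by
   the relations since each of them is nonempty. *)
Record sym_assoc_scheme (X : finType) (d : nat) := SymAssocScheme {
  assoc_rel : 'I_d.+1 -> {set X * X};
  inter_num : 'I_d.+1 -> 'I_d.+1 -> 'I_d.+1 -> nat;
  scheme_nonempty : (0 < #|X|)%N;
  rel_nonempty : forall i, assoc_rel i != set0;
  rel_cover : \bigcup_i assoc_rel i = [set: X * X];
  rel_disjoint : forall i j, i != j -> [disjoint assoc_rel i & assoc_rel j];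
  rel_diag : assoc_rel ord0 = [set u | u.1 == u.2];
  rel_sym : forall i x y, (x, y) \in assoc_rel i -> (y, x) \in assoc_rel i;
  rel_regular : forall h i j x y, (x, y) \in assoc_rel h ->
    inter_num h i j =
      #|[set z | ((x, z) \in assoc_rel i) && ((z, y) \in assoc_rel j)]|
}.

(* Entrywise product. *)
Definition hadamard (C : pzRingType) (m n : nat) (A B : 'M[C]_(m, n)) :
    'M[C]_(m, n) :=
  map2_mx (fun a b => a * b) A B.

(* Rows and columns of a matrix in Mat_X(C) are indexed by 'I_#|X| through the
   enumeration [enum_val] of X. *)
Definition assoc_mx (C : fieldType) (X : finType) (d : nat)
    (S : sym_assoc_scheme X d) (i : 'I_d.+1) : 'M[C]_#|X| :=
  \matrix_(x, y) ((enum_val x, enum_val y) \in assoc_rel S i)%:R.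

Definition assoc_tuple (C : fieldType) (X : finType) (d : nat)
    (S : sym_assoc_scheme X d) : d.+1.-tuple 'M[C]_#|X| :=
  [tuple assoc_mx C S i | i < d.+1].

Definition bose_mesner (C : fieldType) (X : finType) (d : nat)
    (S : sym_assoc_scheme X d) : {vspace 'M[C]_#|X|} :=
  <<assoc_tuple C S>>%VS.

(* [E] enumerates the primitive idempotents of the Bose-Mesner algebra: a basis
   of mutually orthogonal idempotents summing to I is the family of primitive
   idempotents, up to order. *)
Record idempotent_ordering (C : fieldType) (X : finType) (d : nat)
    (S : sym_assoc_scheme X d) (E : 'I_d.+1 -> 'M[C]_#|X|) : Prop :=
  IdempotentOrdering {
    idem_basis : basis_of (bose_mesner C S) [tuple E i | i < d.+1];
    idem_sum : \sum_i E i = 1%:M;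
    idem_mul : forall i j, E i *m E j = if i == j then E i else 0;
    idem_first : E ord0 = #|X|%:R^-1 *: const_mx 1
  }.

(* P_{i,j} is the coefficient of E_i in A_j. *)
Definition first_eigenmatrix (C : fieldType) (X : finType) (d : nat)
    (S : sym_assoc_scheme X d) (E : 'I_d.+1 -> 'M[C]_#|X|) : 'M[C]_d.+1 :=
  \matrix_(i, j) coord [tuple E k | k < d.+1] i (assoc_mx C S j).

(* Q_{i,j} is |X| times the coefficient of A_i in E_j. *)
Definition second_eigenmatrix (C : fieldType) (X : finType) (d : nat)
    (S : sym_assoc_scheme X d) (E : 'I_d.+1 -> 'M[C]_#|X|) : 'M[C]_d.+1 :=
  \matrix_(i, j) (#|X|%:R * coord (assoc_tuple C S) i (E j)).

(* q^h_{i,j} is |X| times the coefficient of E_h in the entrywise product of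
   E_i and E_j. *)
Definition krein (C : fieldType) (X : finType) (d : nat)
    (E : 'I_d.+1 -> 'M[C]_#|X|) (h i j : 'I_d.+1) : C :=
  #|X|%:R * coord [tuple E k | k < d.+1] h (hadamard (E i) (E j)).

Definition formally_self_dual (C : fieldType) (X : finType) (d : nat)
    (S : sym_assoc_scheme X d) (E : 'I_d.+1 -> 'M[C]_#|X|) : Prop :=
  first_eigenmatrix S E = second_eigenmatrix S E.

Definition numerically_self_dual (C : fieldType) (X : finType) (d : nat)
    (S : sym_assoc_scheme X d) (E : 'I_d.+1 -> 'M[C]_#|X|) : Prop :=
  forall h i j, (inter_num S h i j)%:R = krein E h i j.

Definition Q_polynomial (C : fieldType) (X : finType) (d : nat)
    (E : 'I_d.+1 -> 'M[C]_#|X|) : Prop :=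
  forall h i j : 'I_d.+1,
    ([|| i + j < h, h + j < i | h + i < j]%N -> krein E h i j = 0) /\
    ([|| h == i + j :> nat, i == h + j :> nat | j == h + i :> nat]%N ->
       krein E h i j != 0).

(* [coord] is only meaningful on the span of a free family. The following shows
   that P, Q and the Krein parameters satisfy their defining equations. *)
Section DefiningEquations.

Variables (C : numFieldType) (X : finType) (d : nat).
Variables (S : sym_assoc_scheme X d) (E : 'I_d.+1 -> 'M[C]_#|X|).
Hypothesis E_ord : idempotent_ordering S E.

Let X_neq0 : #|X|%:R != 0 :> C.
Proof. by rewrite pnatr_eq0 -lt0n (scheme_nonempty S). Qed.

Lemma assoc_mx_hadamard i j :
  hadamard (assoc_mx C S i) (assoc_mx C S j) =
  if i == j then assoc_mx C S i else 0.
Proof.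
apply/matrixP=> x y; rewrite !mxE; case: (eqVneq i j) => [->|nij].
  by rewrite mxE -natrM mulnb andbb.
rewrite mxE -natrM mulnb; case: andP => // -[xi xj].
by have /pred0P/(_ (enum_val x, enum_val y)) := rel_disjoint S nij;
  rewrite /= xi xj.
Qed.

Lemma assoc_mx_mem i : assoc_mx C S i \in bose_mesner C S.
Proof. by apply/memv_span/mapP; exists i; rewrite ?mem_enum. Qed.

Lemma assoc_nth (i : 'I_d.+1) : (assoc_tuple C S)`_i = assoc_mx C S i.
Proof. by rewrite -tnth_nth tnth_mktuple. Qed.

Lemma assoc_basis : basis_of (bose_mesner C S) (assoc_tuple C S).
Proof.
rewrite /basis_of eqxx; apply/freeP=> k kA0 i.
have /set0Pn[[x y] xyi] := rel_nonempty S i.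
have := congr1 (fun M : 'M_#|X| => M (enum_rank x) (enum_rank y)) kA0.
under eq_bigr do rewrite assoc_nth.
rewrite summxE (bigD1 i) // big1 => [|j nij].
  by rewrite !mxE !enum_rankK xyi mulr1 /= addr0.
rewrite !mxE !enum_rankK.
have /pred0P/(_ (x, y)) := rel_disjoint S nij.
by rewrite /= xyi andbT => ->; rewrite mulr0.
Qed.

Lemma bose_mesner_hadamard A B :
  A \in bose_mesner C S -> B \in bose_mesner C S ->
  hadamard A B \in bose_mesner C S.
Proof.
move=> /coord_span defA /coord_span defB.
have -> : hadamard A B = \sum_i \sum_j
    (coord (assoc_tuple C S) i A * coord (assoc_tuple C S) j B) *:
      hadamard (assoc_mx C S i) (assoc_mx C S j).
  apply/matrixP=> x y; rewrite {1}defA {1}defB !mxE !summxE mulr_suml.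
  apply: eq_bigr => i _; rewrite summxE mulr_sumr; apply: eq_bigr => j _.
  by rewrite !assoc_nth !mxE mulrACA.
apply: rpred_sum => i _; apply: rpred_sum => j _; apply: rpredZ.
rewrite assoc_mx_hadamard; case: ifP => _; last exact: mem0v.
exact: assoc_mx_mem.
Qed.

Lemma idem_mem i : E i \in bose_mesner C S.
Proof.
apply: (basis_mem (idem_basis E_ord)).
by apply/mapP; exists i; rewrite ?mem_enum.
Qed.

Lemma first_eigenmatrixE j :
  assoc_mx C S j = \sum_i first_eigenmatrix S E i j *: E i.
Proof.
rewrite [LHS](coord_basis (idem_basis E_ord) (assoc_mx_mem j)).
by apply: eq_bigr => i _; rewrite mxE -tnth_nth tnth_mktuple.
Qed.

Lemma second_eigenmatrixE j :
  E j = #|X|%:R^-1 *: \sum_i second_eigenmatrix S E i j *: assoc_mx C S i.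
Proof.
rewrite [LHS](coord_span (idem_mem j)) scaler_sumr.
apply: eq_bigr => i _.
by rewrite mxE scalerA mulrA mulVf // mul1r assoc_nth.
Qed.

Lemma kreinE i j :
  hadamard (E i) (E j) = #|X|%:R^-1 *: \sum_h krein E h i j *: E h.
Proof.
have Eij := bose_mesner_hadamard (idem_mem i) (idem_mem j).
rewrite [LHS](coord_basis (idem_basis E_ord) Eij) scaler_sumr.
apply: eq_bigr => h _.
by rewrite scalerA mulrA mulVf // mul1r -tnth_nth tnth_mktuple.
Qed.

End DefiningEquations.

(* Main.v *)
(** The rows of the first (second) eigenmatrix are the characters of the algebra
whose structure constants are the intersection numbers (Krein parameters).
Inverting the eigenmatrices recovers the structure constants, which gives
(i) => (ii).  Conversely, if the structure constants agree then the rows of Q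
are rows of P, say Q_{i,j} = P_{s(i),j}, and the valencies k_j = p^0_{j,j} agree
with the multiplicities q^0_{j,j}.  Then k_i P_{i,j} = k_j Q_{j,i} becomes
k_i P_{i,j} = k_j P_{s(j),i}.  By the Q-polynomial recurrence the entries
P_{i,1} are pairwise distinct.  Taking i = j = 1 gives P_{1,1} = P_{s(1),1}, so
s(1) = 1; hence k_i P_{i,1} = k_1 P_{1,i} = k_i P_{s(i),1}, so s(i) = i. *)
Require Import Defs.
From mathcomp Require Import all_boot all_order all_algebra.
From mathcomp Require Import reals complex.

Set Implicit Arguments.
Unset Strict Implicit.
Unset Printing Implicit Defensive.

Import GRing.Theory Num.Theory.
Local Open Scope ring_scope.

(** * Characters of an algebra given by structure constants *)

Section Characters.

Variables (C : fieldType) (d : nat).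
Implicit Types (P Q T : 'M[C]_d.+1) (p : 'I_d.+1 -> 'I_d.+1 -> 'I_d.+1 -> C).

Lemma mulmx_scalarC P T (n : C) :
  n != 0 -> T *m P = n%:M -> P *m T = n%:M.
Proof.
move=> n0 TP; have : (n^-1 *: T) *m P = 1%:M.
  by rewrite -scalemxAl TP scale_scalar_mx mulVf.
move/mulmx1C; rewrite -scalemxAr => /(congr1 (fun M => n *: M)).
by rewrite scalerA divff // scale1r scalemx1.
Qed.

(** [v i] is the value at the basis element [e_i] of the algebra with product
    [e_i e_j = \sum_h p h i j e_h]. Only multiplicativity is asked; [v ord0 = 1] is imposed
    separately to exclude the zero map. *)
Definition is_character p (v : 'I_d.+1 -> C) :=
  forall i j, v i * v j = \sum_h p h i j * v h.

(** The character identity makes [P r i * P r j] linear in row [r], and [T *m P = n%:M] then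
    isolates the coefficient at [h]. *)
Lemma structure_constantE p P T (n : C) h i j :
    T *m P = n%:M -> (forall r, is_character p (P r)) ->
  \sum_r T h r * (P r i * P r j) = n * p h i j.
Proof.
move=> TP chP; under eq_bigr do rewrite chP mulr_sumr.
rewrite exchange_big /= (bigD1 h) //= [X in _ + X]big1 => [|l nlh].
  under eq_bigr do rewrite mulrCA.
  rewrite -mulr_sumr; have := congr1 (fun M : 'M_d.+1 => M h h) TP.
  by rewrite !mxE eqxx => ->; rewrite addr0 mulrC.
under eq_bigr do rewrite mulrCA.
rewrite -mulr_sumr; have := congr1 (fun M : 'M_d.+1 => M h l) TP.
by rewrite !mxE eq_sym (negPf nlh) => ->; rewrite mulr0.
Qed.

(** The symmetry hypothesis turns [P ord0 r * Q r i] into [Q ord0 i * P i r], leaving a diagonal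
    entry of [P *m Q]. *)
Lemma structure_constant0 p P Q (n : C) i :
    n != 0 -> P *m Q = n%:M -> (forall r, is_character p (Q r)) ->
    (forall a b, Q ord0 a * P a b = P ord0 b * Q b a) ->
  p ord0 i i = Q ord0 i.
Proof.
move=> n0 PQ chQ PQsym; apply: (mulfI n0).
rewrite -(structure_constantE _ _ _ PQ chQ).
under eq_bigr do rewrite mulrA -PQsym -mulrA.
rewrite -mulr_sumr; have := congr1 (fun M : 'M_d.+1 => M i i) PQ.
by rewrite !mxE eqxx => ->; rewrite mulrC.
Qed.

(* The coordinates of [v] on the rows of [P] are its values at orthogonal
   idempotents summing to the unit, hence all but one of them vanish. *)
Lemma character_is_row p P T (n : C) v :
    n != 0 -> T *m P = n%:M -> (forall r, is_character p (P r)) ->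
    is_character p v -> v ord0 = 1 ->
  exists r, forall j, v j = P r j.
Proof.
move=> n0 TP chP chv v0.
have PT := mulmx_scalarC n0 TP.
pose c r := n^-1 * \sum_j v j * T j r.
have vE j : v j = \sum_r c r * P r j.
  rewrite /c; under eq_bigr do rewrite -mulrA mulr_suml.
  rewrite -mulr_sumr exchange_big /=.
  under eq_bigr do under eq_bigr do rewrite -mulrA.
  under eq_bigr do rewrite -mulr_sumr.
  rewrite (bigD1 j) //= [X in _ + X]big1 ?addr0 => [|k nkj].
    have := congr1 (fun M : 'M_d.+1 => M j j) TP.
    by rewrite !mxE eqxx => ->; rewrite mulrCA mulVf ?mulr1.
  have := congr1 (fun M : 'M_d.+1 => M k j) TP.
  by rewrite !mxE (negPf nkj) => ->; rewrite mulr0.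
have PTE t r : \sum_j P t j * T j r = n * (t == r)%:R.
  have := congr1 (fun M : 'M_d.+1 => M t r) PT.
  by rewrite !mxE => ->; rewrite mulr_natr.
have cM r s : r != s -> c r * c s = 0.
  move=> nrs; rewrite /c mulrACA mulr_suml.
  suff -> : \sum_i v i * T i r * (\sum_j v j * T j s) = 0 by rewrite mulr0.
  (* Since [v] and the rows of [P] are all multiplicative, the product is computed row by row, where
     [PTE] makes each factor a Kronecker delta. *)
  transitivity (\sum_t c t * ((\sum_i P t i * T i r) * (\sum_j P t j * T j s))).
    under [RHS]eq_bigr do rewrite mulr_suml mulr_sumr.
    rewrite [RHS]exchange_big; apply: eq_bigr => i _.
    under [RHS]eq_bigr do rewrite !mulr_sumr.
    rewrite mulr_sumr [RHS]exchange_big; apply: eq_bigr => j _.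
    rewrite mulrACA chv.
    transitivity ((\sum_t c t * (P t i * P t j)) * (T i r * T j s)).
      congr (_ * _).
      under eq_bigr do rewrite vE mulr_sumr.
      rewrite exchange_big; apply: eq_bigr => t _ /=.
      by rewrite chP mulr_sumr; apply: eq_bigr => h _; rewrite mulrCA.
    rewrite mulr_suml; apply: eq_bigr => t _; rewrite -mulrA.
    by congr (_ * _); rewrite mulrACA.
  rewrite big1 // => t _; rewrite !PTE.
  case: (eqVneq t r) => [->|_]; last by rewrite mulr0 mul0r mulr0.
  by rewrite (negPf nrs) !mulr0.
have [r cr0] : exists r, c r != 0.
  apply/existsP; apply: contraT; rewrite negb_exists => /forallP c0.
  have /eqP := v0; rewrite vE big1 ?(eq_sym 0) ?oner_eq0 // => r _.
  by have /negPn/eqP-> := c0 r; rewrite mul0r.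
have vr j : v j = c r * P r j.
  rewrite vE (bigD1 r) //= big1 ?addr0 // => s nsr.
  by have /eqP := cM _ _ nsr; rewrite mulf_eq0 (negPf cr0) orbF => /eqP->;
    rewrite mul0r.
(* Multiplicativity at [(ord0, j)] gives [v ord0 * v j = c r * P r ord0 * P r j = v ord0 * P r j],
   so [v ord0 = 1] removes the scalar. *)
exists r => j; rewrite -[LHS]mul1r -v0 chv.
transitivity (c r * (P r ord0 * P r j)); last by rewrite mulrA -vr v0 mul1r.
by rewrite chP mulr_sumr; apply: eq_bigr => h _; rewrite vr mulrCA.
Qed.

(* The Q-polynomial condition makes each entry of a character a polynomial in
   the entry of index 1. *)
Lemma character_eq p (v w : 'I_d.+1 -> C) (i1 : 'I_d.+1) :
    i1 = 1%N :> nat ->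
    (forall h j : 'I_d.+1, (j.+1 < h)%N -> p h i1 j = 0) ->
    (forall h j : 'I_d.+1, h = j.+1 :> nat -> p h i1 j != 0) ->
    is_character p v -> is_character p w ->
    v ord0 = w ord0 -> v i1 = w i1 ->
  v =1 w.
Proof.
move=> i1E p0 pN0 chv chw e0 e1 [j ltj].
elim/ltn_ind: j ltj => -[|j] IH ltj.
  by rewrite (_ : Ordinal ltj = ord0) //; apply: val_inj.
have ltj' := ltnW ltj.
pose j' := Ordinal ltj'; pose h0 := Ordinal ltj.
(* In the expansion of [u i1 * u j'] the entry of index [j+1] has nonzero coefficient and higher
   ones have coefficient zero, so it is determined by lower entries. *)
apply: (mulfI (pN0 h0 j' erefl)).
have split u : is_character p u ->
    p h0 i1 j' * u h0 = u i1 * u j' - \sum_(h | h != h0) p h i1 j' * u h.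
  by move=> ->; rewrite (bigD1 h0) //= addrK.
rewrite !split // e1 (IH j) //; congr (_ - _); apply: eq_bigr => h nh.
have [lth|gth|eqh] := ltngtP h j.+1.
- by congr (_ * _); have := IH h lth (ltn_ord h);
    rewrite (_ : Ordinal _ = h) //; apply: val_inj.
- by rewrite p0 // !mul0r.
- by case/eqP: nh; apply: val_inj.
Qed.

End Characters.

(** * Eigenmatrices of a scheme: inversion and characters *)

Section Eigenmatrices.

Variables (C : numFieldType) (X : finType) (d : nat).
Variables (S : sym_assoc_scheme X d) (E : 'I_d.+1 -> 'M[C]_#|X|).
Hypothesis E_ord : idempotent_ordering S E.

Local Notation A := (assoc_mx C S).
Local Notation P := (first_eigenmatrix S E).
Local Notation Q := (second_eigenmatrix S E).
Local Notation n := (#|X|%:R : C).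

Lemma card_scheme_neq0 : n != 0.
Proof. by rewrite pnatr_eq0 -lt0n (scheme_nonempty S). Qed.

Lemma rel_exists (x y : X) : exists r, (x, y) \in assoc_rel S r.
Proof.
by have /bigcupP[r _ xyr] : (x, y) \in \bigcup_i assoc_rel S i;
  [rewrite rel_cover inE | exists r].
Qed.

Lemma rel_unique (x y : X) r j :
  (x, y) \in assoc_rel S r -> ((x, y) \in assoc_rel S j) = (j == r).
Proof.
move=> xyr; case: (eqVneq j r) => [->//|njr].
by have /pred0P/(_ (x, y)) := rel_disjoint S njr; rewrite /= xyr andbT.
Qed.

Lemma idem_entry x y r j :
  (enum_val x, enum_val y) \in assoc_rel S r -> E j x y = n^-1 * Q r j.
Proof.
move=> xyr; rewrite {1}(second_eigenmatrixE E_ord) mxE summxE; congr (_ * _).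
rewrite (bigD1 r) //= big1 => [|k nkr]; rewrite !mxE (rel_unique _ xyr).
  by rewrite eqxx mulr1 addr0.
by rewrite (negPf nkr) mulr0.
Qed.

Lemma rel_entry r : exists x y : 'I_#|X|,
  (enum_val x, enum_val y) \in assoc_rel S r.
Proof.
have /set0Pn[[x y] xyr] := rel_nonempty S r.
by exists (enum_rank x), (enum_rank y); rewrite !enum_rankK.
Qed.

(** Evaluate the expansion of [A j] in the idempotents at a pair in relation [r]: [E i] contributes
    [n^-1 * Q r i]. *)
Lemma second_first_eigenmatrix : Q *m P = n%:M.
Proof.
apply/matrixP=> r j; have [x [y xyr]] := rel_entry r.
have := congr1 (fun M : 'M_#|X| => M x y) (first_eigenmatrixE E_ord j).
rewrite summxE [LHS]mxE (rel_unique _ xyr).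
under eq_bigr do rewrite mxE (idem_entry _ xyr) mulrCA.
rewrite -mulr_sumr => /(congr1 (fun z => n * z)).
rewrite mulVKf ?card_scheme_neq0 // => PQ.
have -> : n%:M r j = n * (j == r)%:R by rewrite mxE eq_sym mulr_natr.
by rewrite PQ mxE; apply: eq_bigr => i _; rewrite mulrC.
Qed.

Lemma first_second_eigenmatrix : P *m Q = n%:M.
Proof. exact: mulmx_scalarC card_scheme_neq0 second_first_eigenmatrix. Qed.

Lemma idem_assoc_mul r j : E r *m A j = P r j *: E r.
Proof.
rewrite {1}(first_eigenmatrixE E_ord) mulmx_sumr (bigD1 r) //= big1 => [|k nkr].
  by rewrite -scalemxAr (idem_mul E_ord) eqxx addr0.
by rewrite -scalemxAr (idem_mul E_ord) eq_sym (negPf nkr) scaler0.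
Qed.

Lemma assoc_mul i j : A i *m A j = \sum_h (inter_num S h i j)%:R *: A h.
Proof.
apply/matrixP=> x y; have [r xyr] := rel_exists (enum_val x) (enum_val y).
rewrite summxE (bigD1 r) //= [X in _ + X]big1 => [|k nkr]; last first.
  by rewrite !mxE (rel_unique _ xyr) (negPf nkr) mulr0.
rewrite !mxE xyr mulr1 addr0 (rel_regular i j xyr).
rewrite -[X in _ = X%:R]sum1_card natr_sum
  [RHS]big_mkcond /= [RHS](reindex _ (onW_bij _ (enum_val_bij X))) /=.
by apply: eq_bigr => z _; rewrite !mxE !inE -natrM mulnb; case: ifP.
Qed.

Lemma idem_neq0 r : E r != 0.
Proof.
have := free_not0 (v := E r) (basis_free (idem_basis E_ord)); apply.
by apply/mapP; exists r; rewrite ?mem_enum.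
Qed.

(** [P r j] is the eigenvalue of [A j] on [E r], so multiplying [assoc_mul] by [E r] gives the
    identity. *)
Lemma first_eigenmatrix_character r :
  is_character (fun h i j => (inter_num S h i j)%:R) (P r).
Proof.
move=> i j; apply/eqP; rewrite -subr_eq0.
suff : (P r i * P r j - \sum_h (inter_num S h i j)%:R * P r h) *: E r = 0.
  by move/eqP; rewrite scaler_eq0 (negPf (idem_neq0 r)) orbF.
have := congr1 (mulmx (E r)) (assoc_mul i j).
rewrite mulmxA idem_assoc_mul -scalemxAl idem_assoc_mul scalerA mulmx_sumr.
move=> eqE; rewrite scalerBl eqE scaler_suml; apply/eqP; rewrite subr_eq0.
by apply/eqP/eq_bigr => h _; rewrite -scalemxAr idem_assoc_mul scalerA.
Qed.

(** Taking the entry at a pair in relation [r] is multiplicative for the entrywise product. *)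
Lemma second_eigenmatrix_character r : is_character (krein E) (Q r).
Proof.
have n0 := card_scheme_neq0.
move=> i j; have [x [y xyr]] := rel_entry r.
have := congr1 (fun M : 'M_#|X| => M x y) (kreinE E_ord i j).
rewrite [LHS]mxE [RHS]mxE !(idem_entry _ xyr) summxE mulrACA -mulrA.
move/(mulfI (invr_neq0 n0))/(congr1 (fun z => n * z)).
rewrite mulVKf // mulr_sumr => ->; apply: eq_bigr => h _.
by rewrite mxE (idem_entry _ xyr) mulrCA mulVKf.
Qed.

Lemma assoc_mx0 : A ord0 = 1%:M.
Proof.
apply/matrixP=> x y; rewrite !mxE rel_diag inE /=.
by rewrite (inj_eq enum_val_inj).
Qed.

Lemma first_eigenmatrix_col0 r : P r ord0 = 1.
Proof.
have := idem_assoc_mul r ord0; rewrite assoc_mx0 mulmx1 -{1}[E r]scale1r.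
move/eqP; rewrite -subr_eq0 -scalerBl scaler_eq0 (negPf (idem_neq0 r)) orbF.
by rewrite subr_eq0 eq_sym => /eqP.
Qed.

Lemma second_eigenmatrix_col0 r : Q r ord0 = 1.
Proof.
have [x [y xyr]] := rel_entry r; have := idem_entry ord0 xyr.
rewrite (idem_first E_ord) !mxE.
by move/(mulfI (invr_neq0 card_scheme_neq0)).
Qed.

(** * Traces, valencies and multiplicities *)

Lemma mxtrace_idem i : \tr (E i) = Q ord0 i.
Proof.
rewrite /mxtrace (eq_bigr (fun _ => n^-1 * Q ord0 i)) => [|x _].
  rewrite sumr_const card_ord -[LHS]mulr_natl mulVKf //.
  exact: card_scheme_neq0.
by apply: idem_entry; rewrite rel_diag inE.
Qed.

Lemma mxtrace_idem_assoc i j :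
  \tr (E i *m A j) = n^-1 * Q j i * #|assoc_rel S j|%:R.
Proof.
rewrite -[X in _ = _ * X%:R]sum1_card natr_sum mulr_sumr big_mkcond /=.
rewrite (eq_bigr (fun u => if (u.1, u.2) \in assoc_rel S j
    then n^-1 * Q j i * 1 else 0)); last by case.
rewrite -(pair_big xpredT xpredT (fun x y => if (x, y) \in assoc_rel S j
    then n^-1 * Q j i * 1 else 0)) /=.
rewrite (reindex _ (onW_bij _ (enum_val_bij X))) /=; apply: eq_bigr => x _.
rewrite mxE (reindex _ (onW_bij _ (enum_val_bij X))) /=.
apply: eq_bigr => y _; rewrite [A j y x]mxE.
case: ifP => [xyj|nxyj]; first by rewrite (rel_sym xyj) (idem_entry _ xyj).
by case: (boolP (_ \in _)) => [/rel_sym|_]; rewrite ?nxyj ?mulr0.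
Qed.

Lemma mxtrace_idem_assocP i j : \tr (E i *m A j) = P i j * Q ord0 i.
Proof. by rewrite idem_assoc_mul mxtraceZ mxtrace_idem. Qed.

(** Both trace formulas at [E ord0] agree; this identifies [P ord0 j] with the valency of relation
    [j]. *)
Lemma card_assoc_rel j : n^-1 * #|assoc_rel S j|%:R = P ord0 j.
Proof.
have := mxtrace_idem_assoc ord0 j.
by rewrite mxtrace_idem_assocP !second_eigenmatrix_col0 !mulr1 => ->.
Qed.

Lemma first_eigenmatrix_row0_neq0 j : P ord0 j != 0.
Proof.
rewrite -card_assoc_rel mulf_neq0 ?invr_neq0 ?card_scheme_neq0 //.
by rewrite pnatr_eq0 cards_eq0 rel_nonempty.
Qed.

(** Both sides equal the trace of [E i *m A j]. *)
Lemma eigenmatrix_duality i j : Q ord0 i * P i j = P ord0 j * Q j i.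
Proof.
by rewrite mulrC -mxtrace_idem_assocP mxtrace_idem_assoc mulrAC card_assoc_rel.
Qed.

(** * Formal versus numerical self-duality *)

Lemma formally_numerically_self_dual :
  formally_self_dual S E -> numerically_self_dual S E.
Proof.
move=> PQ h i j; apply: (mulfI card_scheme_neq0).
rewrite -(structure_constantE h i j second_first_eigenmatrix
  first_eigenmatrix_character).
rewrite -(structure_constantE h i j first_second_eigenmatrix
  second_eigenmatrix_character).
by rewrite PQ.
Qed.

Lemma numerically_formally_self_dual :
  (1 <= d)%N -> Q_polynomial E ->
  numerically_self_dual S E -> formally_self_dual S E.
Proof.
move=> d1 Qpol pq.
have chP r : is_character (krein E) (P r).
  by move=> i j; rewrite first_eigenmatrix_character; apply: eq_bigr => h _;
    rewrite pq.
have n0 := card_scheme_neq0.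
(* Rows of [P] and of [Q] are now characters for the same constants, so both sides equal
   [krein E ord0 i i]. *)
have PQ0 i : P ord0 i = Q ord0 i.
  rewrite -(structure_constant0 i n0 first_second_eigenmatrix
    second_eigenmatrix_character eigenmatrix_duality).
  apply/esym/(structure_constant0 i n0 second_first_eigenmatrix chP).
  by move=> a b; rewrite eigenmatrix_duality.
have rowQ i : exists s, forall j, Q i j = P s j.
  exact: (character_is_row n0 second_first_eigenmatrix chP
    (second_eigenmatrix_character i) (second_eigenmatrix_col0 i)).
pose i1 : 'I_d.+1 := Ordinal (d1 : (1 < d.+1)%N).
have P1_inj a b : P a i1 = P b i1 -> P a =1 P b.
  apply: (character_eq (p := krein E)) => //.
  - by move=> h j lt; apply: (Qpol h i1 j).1; rewrite add1n lt.
  - by move=> h j eq; apply: (Qpol h i1 j).2; rewrite add1n eq eqxx.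
  - by rewrite !first_eigenmatrix_col0.
have dual i j : P ord0 i * P i j = P ord0 j * Q j i.
  by rewrite PQ0 eigenmatrix_duality.
have k0 := first_eigenmatrix_row0_neq0.
have Q1 j : Q i1 j = P i1 j.
  have [s sE] := rowQ i1; rewrite sE; apply: P1_inj.
  by rewrite -sE; apply: (mulfI (k0 i1)); rewrite dual.
apply/matrixP=> i j; have [s sE] := rowQ i; rewrite sE.
apply: P1_inj; rewrite -sE; apply: (mulfI (k0 i)).
by rewrite dual Q1 dual.
Qed.

End Eigenmatrices.

Theorem theorem6p4 (R : realType) (X : finType) (d : nat) (hd : (1 <= d)%N)
    (S : sym_assoc_scheme X d) (E : 'I_d.+1 -> 'M[R[i]]_#|X|)
    (hE : idempotent_ordering S E) (hQ : Q_polynomial E) :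
  formally_self_dual S E <-> numerically_self_dual S E.
Proof.
split; first exact: formally_numerically_self_dual.
exact: numerically_formally_self_dual.
Qed.
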